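(* Let $G\cong(\underbrace{0,\ldots,0}_{k_1},\underbrace{1,\ldots,1}_{t_1})$, where $t_1,k_1\ge 1$. If $k_1\le t_1$, then $q(G)=2$; otherwise $q(G)=3$.
   Context: For a simple graph $G$ on $n$ vertices, $S(G)$ is the set of all real symmetric $n\times n$ matrices $A=(a_{ij})$ such that for $i\neq j$, $a_{ij}\neq 0$ if and only if $ij\in E(G)$ (diagonal entries are unrestricted). $q(A)$ is the number of distinct eigenvalues of $A$ and $q(G)=\min\{q(A): A\in S(G)\}$. The notation $G\cong(b_1,\ldots,b_n)$, with $b_i\in\{0,1\}$ and $b_1=0$, means that $G$ is the threshold graph with creation sequence $(b_1,\ldots,b_n)$: its vertices are $v_1,\ldots,v_n$ and, for $i<j$, $v_i$ and $v_j$ are adjacent if and only if $b_j=1$. *)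

(* Defs.v *)
From mathcomp Require Import all_boot all_order all_fingroup all_algebra finmap.
From mathcomp Require Import boolp classical_sets cardinality reals.

Set Implicit Arguments.
Unset Strict Implicit.
Unset Printing Implicit Defensive.

Import GRing.Theory Num.Theory.

Local Open Scope ring_scope.
Local Open Scope classical_set_scope.

Record sgraph (n : nat) := SGraph {
  adj : rel 'I_n;
  adj_sym : symmetric adj;
  adj_irr : irreflexive adj }.

(* [v] enumerates the vertices in the order of creation. *)
Definition threshold (n : nat) (G : sgraph n) (b : n.-tuple bool) : Prop :=
  ohead b = Some false /\
  exists v : 'S_n, forall i j : 'I_n, (i < j)%N -> adj G (v i) (v j) = tnth b j.

Definition graph_mx (R : realType) (n : nat) (G : sgraph n) : set 'M[R]_n :=
  [set A | A^T = A /\ forall i j, i != j -> (A i j != 0) = adj G i j].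

Definition spectrum (R : realType) (n : nat) (A : 'M[R]_n) : set R :=
  [set a | eigenvalue A a].

Lemma finite_spectrum (R : realType) (n : nat) (A : 'M[R]_n) :
  finite_set (spectrum A).
Proof.
have p0 : char_poly A != 0 by rewrite monic_neq0 ?char_poly_monic.
apply: contrapT => /(infinite_set_fset n.+1)[B BA].
apply/negP; rewrite -ltnNge ltnS -ltnS -(size_char_poly A).
apply: max_poly_roots p0 _ (fset_uniq B).
by apply/allP => a /BA; rewrite /spectrum /= eigenvalue_root_char.
Qed.

(* [fset_set] is junk on infinite sets; harmless here by [finite_spectrum]. *)
Definition q_mx (R : realType) (n : nat) (A : 'M[R]_n) : nat :=
  #|` fset_set (spectrum A)|.

Definition q_attained (R : realType) (n : nat) (G : sgraph n) : pred nat :=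
  fun k => `[< exists2 A : 'M[R]_n, graph_mx G A & q_mx A = k >].

Lemma q_attained_ex (R : realType) (n : nat) (G : sgraph n) :
  exists k, q_attained R G k.
Proof.
pose A : 'M[R]_n := \matrix_(i, j) (adj G i j)%:R.
exists (q_mx A); apply/asboolP; exists A => //; split.
  by apply/matrixP => i j; rewrite !mxE adj_sym.
by move=> i j _; rewrite mxE pnatr_eq0 eqb0 negbK.
Qed.

Definition q_graph (R : realType) (n : nat) (G : sgraph n) : nat :=
  ex_minn (q_attained_ex R G).

(* Main.v *)
Require Import Defs.
From mathcomp Require Import all_boot all_order all_fingroup all_algebra finmap.
From mathcomp Require Import boolp classical_sets cardinality reals.
From mathcomp Require Import complex zify ring lra.

(** A symmetric matrix is annihilated by the product of the [A - a] over its
distinct eigenvalues [a]; hence [q A <= 1] forces [A] to be scalar, and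
[q A <= 2] forces [A ^ 2 = a A + b].  If [B] is the [k x t] block of [A] between
the independent set and the clique, the latter makes [B B^T] diagonal with
positive diagonal, so [k <= t].

For [k <= t], start from the Householder matrix [H = N - 2 u u^T] with
[u = (1, 2, 2, ...)] and [N = |u| ^ 2]: it satisfies [H ^ 2 = N ^ 2], and it is
nowhere zero because [N] is odd.  Let [V] be its first [k] columns,
[F = diag (2, 1, 1, ...)] and [U = [I; V F]].  The columns of [U] are orthogonal
and a multiple of the projection onto their span realizes the graph; the
exceptional first weight is needed for the clique when [k = t], as [V V^T] is
then diagonal.

For [k > t], the matrix with blocks [0], [J], [J^T], [a J], [a = (k t - 1) / t],
has spectrum inside [{0, k t, -1}]. *)

Set Implicit Arguments.
Unset Strict Implicit.
Unset Printing Implicit Defensive.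

Import Order.TTheory GRing.Theory Num.Theory.

Local Open Scope ring_scope.

(** * Annihilating polynomials of symmetric matrices *)

Section Spectrum.
Variable R : realType.

Lemma mem_spectrum n (A : 'M[R]_n) a :
  (a \in fset_set (spectrum A)) = eigenvalue A a.
Proof.
rewrite in_fset_set; last exact: finite_spectrum.
by apply/idP/idP; rewrite inE.
Qed.

(** Over the complex numbers [A] becomes Hermitian, hence diagonalizable with a real diagonal, so
    its minimal polynomial has simple roots. Each is an eigenvalue of [A], and divisibility descends
    to [R]. *)
Lemma symmetric_prod_spectrum n (A : 'M[R]_n.+1) : A^T = A ->
  horner_mx A (\prod_(a <- fset_set (spectrum A)) ('X - a%:P)) = 0.
Proof.
move=> symA; set p := \prod_(_ <- _) _.
pose f := real_complex R; pose B := map_mx f A.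
have hB : B \is hermsymmx.
  apply: realsym_hermsym.
    by apply/is_hermitianmxP; apply/matrixP => i j;
      rewrite expr0 scale1r !mxE -[in LHS]symA mxE.
  apply/mxOverP => i j; rewrite mxE; apply/complex_realP; by exists (A i j).
have realB := hermitian_spectral_diag_real hB.
have /hermitian_normalmx/orthomx_spectralP := hB.
set P := spectralmx B; set d := spectral_diag B => eqB.
have uP : P \in unitmx := spectral_unit B.
have minB : mxminpoly B =
    \prod_(r <- undup [seq d 0 i | i <- enum 'I_n.+1]) ('X - r%:P).
  rewrite -mxminpoly_diag; apply: (mxpoly.simmx_minpoly uP); apply/(mxpoly.simmxP uP).
  by rewrite eqB !mulmxA mulmxV // mul1mx.
apply/mxminpoly_minP; rewrite -(dvdp_map f) -mxminpoly_map -/B minB.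
apply: uniq_roots_dvdp; last by rewrite uniq_rootsE undup_uniq.
apply/allP => r; rewrite mem_undup => /[dup] rd /mapP[i _ er].
have : d 0 i \in Num.real by exact: (mxOverP realB).
rewrite -er => /complex_realP[x ex].
have : root (mxminpoly B) r by rewrite minB root_prod_XsubC mem_undup.
rewrite ex mxminpoly_map fmorph_root -eigenvalue_root_min => Ax.
by rewrite fmorph_root root_prod_XsubC mem_spectrum.
Qed.

(** Every eigenvalue is a root of the minimal polynomial, which divides the product; [s] may have
    repetitions or non-eigenvalues. *)
Lemma q_mx_le_size n (A : 'M[R]_n.+1) (s : seq R) :
  horner_mx A (\prod_(a <- s) ('X - a%:P)) = 0 -> (q_mx A <= size s)%N.
Proof.
move/mxminpoly_minP => dvd; apply: uniq_leq_size; first exact: fset_uniq.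
move=> a; rewrite mem_spectrum eigenvalue_root_min => /(root_dvdp dvd).
by rewrite root_prod_XsubC.
Qed.

Lemma horner_mx_prod_XsubC n (A : 'M[R]_n.+1) (s : seq R) :
  horner_mx A (\prod_(a <- s) ('X - a%:P)) = \prod_(a <- s) (A - a%:M).
Proof.
rewrite rmorph_prod; apply: eq_bigr => a _.
by rewrite rmorphB /= horner_mx_X horner_mx_C.
Qed.

Lemma symmetric_annihilator n (A : 'M[R]_n.+1) : A^T = A ->
  exists2 s : seq R, size s = q_mx A & \prod_(a <- s) (A - a%:M) = 0.
Proof.
move=> symA; exists (fset_set (spectrum A)) => //.
by rewrite -horner_mx_prod_XsubC symmetric_prod_spectrum.
Qed.

End Spectrum.

(** * The graph labelled in order of creation *)

Lemma join_adj_sym k t : symmetric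
  [rel i j : 'I_(k + t) | (i != j) && ((k <= i) || (k <= j))%N].
Proof. by move=> i j /=; rewrite eq_sym orbC. Qed.

Lemma join_adj_irr k t : irreflexive
  [rel i j : 'I_(k + t) | (i != j) && ((k <= i) || (k <= j))%N].
Proof. by move=> i /=; rewrite eqxx. Qed.

Definition empty_join_complete k t : sgraph (k + t) :=
  SGraph (@join_adj_sym k t) (@join_adj_irr k t).

(** * Invariance under relabelling, and lower bounds *)

Section GraphSpectrum.
Variable R : realType.

Lemma q_graph_eq n (G : sgraph n) (A : 'M[R]_n) q :
  graph_mx G A -> (q_mx A <= q)%N ->
  (forall B : 'M[R]_n, graph_mx G B -> (q <= q_mx B)%N) -> q_graph R G = q.
Proof.
move=> GA Aq min; rewrite /q_graph; case: ex_minnP => m /asboolP[B GB <-] minm.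
apply/eqP; rewrite eqn_leq min // andbT.
by apply: leq_trans Aq; apply: minm; apply/asboolP; exists A.
Qed.

Lemma spectrum_relabel n (A : 'M[R]_n) (s : 'S_n) :
  spectrum (row_perm s (col_perm s A)) = spectrum A.
Proof.
have sub (u : 'S_n) (B : 'M[R]_n) :
    (spectrum B `<=` spectrum (row_perm u (col_perm u B)))%classic.
  move=> a /eigenvalueP[v vB v0]; apply/eigenvalueP; exists (v *m perm_mx u^-1)%g.
    rewrite row_permE col_permE -!mulmxA (mulmxA (perm_mx u^-1)).
    rewrite -perm_mxM mulVg perm_mx1 mul1mx.
    by rewrite mulmxA vB scalemxAl.
  apply: contra_neq v0 => /(congr1 (mulmx^~ (perm_mx u))).
  by rewrite mul0mx -mulmxA -perm_mxM mulVg perm_mx1 mulmx1.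
apply/seteqP; split; last exact: sub.
(* The converse is [sub] for the inverse permutation. *)
rewrite -{2}(_ : row_perm s^-1 (col_perm s^-1 (row_perm s (col_perm s A))) = A)%g.
  exact: sub.
by apply/matrixP => i j; rewrite !mxE !permKV.
Qed.

Lemma q_graph_relabel n (G H : sgraph n) (s : 'S_n) :
  (forall i j, adj G (s i) (s j) = adj H i j) -> q_graph R G = q_graph R H.
Proof.
move=> GH; suff eqq q : q_attained R G q = q_attained R H q.
  by rewrite /q_graph; apply: eq_ex_minn.
apply/asboolP/asboolP => -[A [symA GA] <-].
  exists (row_perm s (col_perm s A)); last by rewrite /q_mx spectrum_relabel.
  split=> [|i j ij]; first by apply/matrixP => i j; rewrite !mxE -[in RHS]symA mxE.
  by rewrite !mxE GA ?GH // (inj_eq perm_inj).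
exists (row_perm s^-1 (col_perm s^-1 A))%g; last by rewrite /q_mx spectrum_relabel.
split=> [|i j ij]; first by apply/matrixP => i j; rewrite !mxE -[in RHS]symA mxE.
by rewrite !mxE GA -?GH ?permKV // (inj_eq perm_inj).
Qed.

Lemma graph_mx_scalarN n (G : sgraph n) (A : 'M[R]_n) i j a :
  adj G i j -> graph_mx G A -> A <> a%:M.
Proof.
move=> ij [_ GA] eA; have nij : i != j.
  by apply: contraTneq ij => ->; rewrite adj_irr.
by have := GA i j nij; rewrite eA mxE (negbTE nij) eqxx ij.
Qed.

Lemma q_mx_ge2 n (G : sgraph n.+1) (A : 'M[R]_n.+1) i j :
  adj G i j -> graph_mx G A -> (2 <= q_mx A)%N.
Proof.
move=> ij GA; have [s <-] := symmetric_annihilator GA.1.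
case: s => [|a [|b s]] //=; first by rewrite big_nil => /eqP; rewrite oner_eq0.
rewrite big_seq1 => /eqP; rewrite subr_eq0 => /eqP.
by move/(graph_mx_scalarN ij GA).
Qed.

Lemma q_mx_le2 n (A : 'M[R]_n.+1) : A^T = A -> (q_mx A <= 2)%N ->
  exists a b, A *m A = a *: A + b%:M.
Proof.
move=> symA; have [s <-] := symmetric_annihilator symA.
case: s => [|a [|b [|//]]] /=.
- by rewrite big_nil => /eqP; rewrite oner_eq0.
- rewrite big_seq1 => /eqP; rewrite subr_eq0 => /eqP -> _.
  by exists a, 0; rewrite raddf0 addr0 -scalar_mxM scale_scalar_mx.
rewrite big_cons big_seq1 -mulmxE mulmxBl !mulmxBr mul_mx_scalar !mul_scalar_mx => e _.
exists (a + b), (- (a * b)); apply/matrixP => i j; move/matrixP/(_ i j): e.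
move: (A *m A) => M; rewrite !mxE; move: (M i j) (A i j) => x y.
by case: (i == j); rewrite ?mulr1n ?mulr0n; lra.
Qed.

Lemma graph_mx_empty_join_complete k t
    (h : 'rV[R]_k) (B : 'M[R]_(k, t)) (C : 'M[R]_t) :
  (forall i j, B i j != 0) -> C^T = C -> (forall i j, i != j -> C i j != 0) ->
  graph_mx (empty_join_complete k t) (block_mx (diag_mx h) B B^T C).
Proof.
move=> B0 symC C0; split; first by rewrite tr_block_mx tr_diag_mx trmxK symC.
move=> i j; case: (split_ordP i) => {}i ->; case: (split_ordP j) => {}j -> ij.
- rewrite block_mxEul mxE /= (leqNgt k i) (leqNgt k j) !ltn_ord andbF.
  by rewrite (inj_eq (@lshift_inj _ _)) in ij; rewrite (negbTE ij) mulr0n eqxx.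
- by rewrite block_mxEur B0 /= ij leq_addr orbT.
- by rewrite block_mxEdl mxE B0 /= ij leq_addr.
by rewrite block_mxEdr C0 /= ?ij ?leq_addr // -(inj_eq (@rshift_inj k t)).
Qed.

Lemma q_mx_ge3 k t (A : 'M[R]_(k.+1 + t.+1)) :
  (t < k)%N -> graph_mx (empty_join_complete k.+1 t.+1) A -> (3 <= q_mx A)%N.
Proof.
move=> tk [symA GA]; rewrite ltnNge; apply/negP => /(@q_mx_le2 (k + t.+1)).
(* The equation comes at size [(k + t.+1).+1] and is restated at the convertible block size. *)
case=> // a [b] eA; have {}eA : A *m A = a *: A + b%:M :> 'M_(k.+1 + t.+1) := eA.
pose B := ursubmx A.
have dlA : dlsubmx A = B^T by rewrite /B trmx_ursub symA.
have Bn0 i j : B i j != 0.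
  by rewrite !mxE GA ?eq_lrshift //= eq_lrshift leq_addr orbT.
have ulA i j : i != j -> ulsubmx A i j = 0.
  move=> ij; rewrite !mxE; apply/eqP/negbNE; rewrite GA ?(inj_eq (@lshift_inj _ _)) //.
  by rewrite /= (leqNgt _ i) (leqNgt _ j) !ltn_ord andbF.
have BBt i j : i != j -> (B *m B^T) i j = 0.
  move=> ij; have : ulsubmx (A *m A) i j = 0.
    have := ulA i j ij; rewrite eA !mxE => ->.
    by rewrite mulr0 add0r (inj_eq (@lshift_inj _ _)) (negbTE ij).
  (* The upper left block of [A *m A] is [D *m D + B *m B^T] with [D] diagonal; as [i != j], each
     term of [(D *m D) i j] has an off-diagonal factor. *)
  rewrite -{1 2}(submxK A) mulmx_block block_mxKul dlA mxE.
  rewrite mxE big1 ?add0r // => l _.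
  have [<-|li] := eqVneq i l; last by rewrite ulA ?mul0r.
  by rewrite [X in _ * X]ulA ?mulr0.
have eBBt : B *m B^T = diag_mx (\row_i (B *m B^T) i i).
  apply/matrixP => i j; rewrite [RHS]mxE [X in X *+ _]mxE.
  by have [->|ij] := eqVneq i j; rewrite ?mulr1n // mulr0n BBt.
have uBBt : B *m B^T \in unitmx.
  rewrite unitmxE eBBt det_diag unitfE; apply/prodf_neq0 => i _.
  rewrite 2!mxE gt_eqF // (bigD1 ord0) //= [B^T _ _]mxE ltr_wpDr //.
    by apply: sumr_ge0 => j _; rewrite [B^T _ _]mxE -expr2 sqr_ge0.
  by rewrite -expr2 exprn_even_gt0 //= Bn0.
(* The invertible [B *m B^T] has rank [k.+1], yet [B] has only [t.+1] columns. *)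
have := leq_trans (mxrankM_maxl B B^T) (rank_leq_col B).
by rewrite mxrank_unit // ltnS leqNgt tk.
Qed.

End GraphSpectrum.

(** * The integral Householder matrix *)

Section Householder.

Lemma addMz_neq0 (m q c : int) : c != 0 -> `|c| < m -> m * q + c != 0.
Proof.
move=> c0 cm; apply: contra_neq c0 => /eqP; rewrite addr_eq0 => /eqP mq.
move: cm; rewrite -normrN -mq normrM; have [q0|q0] := eqVneq q 0.
  by move: mq; rewrite q0 mulr0 => /esym/eqP; rewrite oppr_eq0 => /eqP.
have q1 : 1 <= `|q| by lia.
rewrite ltNge => /negP[]; apply: (le_trans (ler_norm m)).
by rewrite ler_peMr.
Qed.


(** Integer values let non-vanishing be settled by residues; [nat] indices let [H] be cut to its
    first columns without index casts. *)
Definition hvec (i : nat) : int := if i == 0%N then 1 else 2.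

Definition hnorm (t : nat) : int := \sum_(i < t) hvec i ^+ 2.

Lemma hnormS t : hnorm t.+1 = 4 * t%:Z + 1.
Proof.
rewrite /hnorm big_ord_recl /=; under eq_bigr do rewrite /hvec /=.
by rewrite sumr_const card_ord -mulr_natl /hvec /= natz; lia.
Qed.

Lemma hvec_neq0 i : hvec i != 0.
Proof. by rewrite /hvec; case: ifP. Qed.

Definition hentry (t i j : nat) : int :=
  hnorm t * (i == j)%:Z - 2 * hvec i * hvec j.

Lemma hentry_neq0 t i j : hentry t.+1 i j != 0.
Proof.
rewrite /hentry hnormS /hvec; case: (i == j); case: (i == 0)%N; case: (j == 0)%N;
  rewrite /= ?mulr1 ?mulr0; apply/eqP; lia.
Qed.

Lemma hentry_ortho t (i j : 'I_t) :
  \sum_(l < t) hentry t i l * hentry t j l = hnorm t ^+ 2 * (i == j)%:Z.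
Proof.
have delta (a : 'I_t) (F : nat -> int) : \sum_(l < t) (a == l :> nat)%:Z * F l = F a.
  rewrite (bigD1 a) //= eqxx mul1r big1 ?addr0 // => l la.
  by rewrite eq_sym (negbTE la : (l == a :> nat) = false) mul0r.
(* Only the first factor is expanded against its delta; the last term sums to
   [4 * hvec i * hvec j * hnorm t]. *)
transitivity (\sum_(l < t) ((i == l :> nat)%:Z * (hnorm t * hentry t j l)
  + (j == l :> nat)%:Z * (- (2 * hnorm t * hvec i * hvec l))
  + 4 * hvec i * hvec j * hvec l ^+ 2)).
  by apply: eq_bigr => l _; rewrite /hentry; ring.
rewrite !big_split /= (delta i (fun l => hnorm t * hentry t j l)).
rewrite (delta j (fun l => - (2 * hnorm t * hvec i * hvec l))) -mulr_sumr -/(hnorm t).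
by rewrite /hentry eq_sym (inj_eq val_inj); ring.
Qed.

(** Both a modulus and the weight [h l * f l ^ 2] of every column but the first, whose weight
    [4 * (1 + N ^ 2)] exceeds it by [3]. *)
Definition hmod t : int := 1 + 4 * hnorm t ^+ 2.

(* The factor in parentheses is [h l * f l ^ 2] in [two_eigenvalues] below.  After
factoring [2 u_i u_j] out, the sum is congruent to [6] or [3 (2 - N)] modulo
[1 + 4 N ^ 2]. *)
Lemma hentry_weighted_neq0 k t i j : i != j -> (0 < t)%N ->
  \sum_(l < k.+1) (hmod t.+1 + 3 * (l == 0 :> nat)%:Z) *
    (hentry t.+1 i l * hentry t.+1 j l) != 0.
Proof.
move=> ij t0; set m := hmod _; pose N := hnorm t.+1.
(* As [i != j], the two deltas are never both [1], so the [N ^ 2] term vanishes and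
   [2 * hvec i * hvec j] factors out. *)
pose y l : int := 2 * hvec l ^+ 2 - N * ((i == l)%:Z + (j == l)%:Z).
have termE l : hentry t.+1 i l * hentry t.+1 j l = 2 * hvec i * hvec j * y l.
  rewrite /hentry -/N /y; have [<-|il] := eqVneq i l.
    by rewrite [j == i]eq_sym (negbTE ij) /=; ring.
  by have [<-|jl] := eqVneq j l; rewrite /=; ring.
rewrite (_ : \sum_(l < _) _ = 2 * hvec i * hvec j *
  (m * (\sum_(l < k.+1) y l) + 3 * y 0%N)); last first.
  rewrite big_ord_recl [in RHS]big_ord_recl /= termE mulr1 !mulrDr.
  rewrite (_ : \sum_(_ < k) _ = 2 * hvec i * hvec j * (m * \sum_(l < k) y l.+1)).
    by ring.
  by rewrite !mulr_sumr; apply: eq_bigr => l _; rewrite termE mulr0 addr0; ring.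
rewrite !mulf_neq0 ?hvec_neq0 //.
move: (\sum_(_ < _) _) => q; rewrite /y /m /hmod -/N /hvec /=.
have N5 : 5 <= N by rewrite /N hnormS; lia.
(* This bound lets linear arithmetic, with [N ^ 2] as an atom, place the residue below the
   modulus. *)
have NN : 5 * N <= N ^+ 2 by rewrite expr2 ler_wpM2r //; lia.
by case: i ij {y termE} => [|i]; case: j => [|j] //= _;
  rewrite ?mulr1 ?mulr0 ?addr0 ?add0r; apply: addMz_neq0; lia.
Qed.

End Householder.

(** * Matrices attaining the bounds *)

Section Realizations.
Variable R : realType.

Lemma two_eigenvalues k t : (k <= t)%N ->
  exists2 A : 'M[R]_(k.+1 + t.+1),
    graph_mx (empty_join_complete k.+1 t.+1) A & (q_mx A <= 2)%N.
Proof.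
move=> kt; pose N : R := (hnorm t.+1)%:~R.
(* [h] is proportional to the inverse of the Gram matrix [U^T U]. *)
pose f : 'rV[R]_k.+1 := \row_l (if l == 0 then 2 else 1).
pose h : 'rV[R]_k.+1 := \row_l (if l == 0 then 1 + N ^+ 2 else 1 + 4 * N ^+ 2).
pose V : 'M[R]_(t.+1, k.+1) := \matrix_(j, l) (hentry t.+1 j l)%:~R.
pose U := col_mx 1%:M (V *m diag_mx f).
pose C := V *m diag_mx f *m diag_mx h *m (V *m diag_mx f)^T.
pose B := diag_mx h *m (V *m diag_mx f)^T.
pose A := block_mx (diag_mx h) B B^T C.
pose s : R := (1 + N ^+ 2) * (1 + 4 * N ^+ 2).
have N1_gt0 : 0 < 1 + N ^+ 2 by have := sqr_ge0 N; lra.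
have N4_gt0 : 0 < 1 + 4 * N ^+ 2 by have := sqr_ge0 N; lra.
have VV : V^T *m V = (N ^+ 2)%:M.
  apply/matrixP => i j; rewrite !mxE.
  (* Here [k <= t] enters: column indices of [V] are row indices of [H], whose symmetry turns
     orthogonal rows into orthogonal columns. *)
  have wi (l : 'I_k.+1) : (l < t.+1)%N by apply: leq_trans (ltn_ord l) _.
  have := hentry_ortho (Ordinal (wi i)) (Ordinal (wi j)).
  move=> /(congr1 (fun z : int => z%:~R : R)).
  rewrite rmorph_sum rmorphM rmorphXn /= -/N => e.
  rewrite -mulr_natr.
  rewrite -[(i == j)%:R]/(((Ordinal (wi i) == Ordinal (wi j))%:Z)%:~R : R) -e.
  apply: eq_bigr => l _; rewrite !mxE rmorphM /hentry /=.
  by rewrite (eq_sym (l : nat)) (eq_sym (l : nat) j); ring.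
have eA : A = U *m diag_mx h *m U^T.
  rewrite /A /B /C /U; move: (V *m diag_mx f) => M.
  rewrite tr_col_mx trmx1 mul_col_mx mul1mx mul_col_row.
  by rewrite !mulmx1 trmx_mul trmxK tr_diag_mx.
have UU : diag_mx h *m (U^T *m U) = s%:M.
  rewrite /U tr_col_mx trmx1 mul_row_col mul1mx trmx_mul tr_diag_mx.
  rewrite mulmxA -(mulmxA (diag_mx f)) VV mul_mx_scalar -scalemxAl mulmx_diag.
  (* The Gram matrix has diagonal [1 + 4 * N ^ 2], then [1 + N ^ 2]; [h] carries the complementary
     factor of [s]. *)
  apply/matrixP => i j; rewrite mul_diag_mx !mxE /s.
  by case: (i == j); case: (i == 0); rewrite ?mulr1n ?mulr0n; ring.
have AA : A *m A = s *: A.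
  rewrite eA -!mulmxA (mulmxA U^T) (mulmxA (diag_mx h)) UU.
  by rewrite mul_scalar_mx -!scalemxAr.
exists A.
  apply: graph_mx_empty_join_complete => [i j||i j ij].
  - rewrite /B mul_diag_mx trmx_mul tr_diag_mx mul_diag_mx !mxE.
    rewrite !mulf_neq0 ?intr_eq0 ?hentry_neq0 //.
      by case: ifP => _; rewrite gt_eqF.
    by case: ifP => _; rewrite ?oner_eq0 ?pnatr_eq0.
  - by rewrite /C !trmx_mul !tr_diag_mx trmxK !mulmxA.
  (* A one-vertex clique has no pair [i != j]. *)
  have t0 : (0 < t)%N by case: (t) i j ij => // i j; rewrite !ord1.
  have := hentry_weighted_neq0 k ij t0.
  rewrite -(intr_eq0 R) rmorph_sum /=; congr (_ != 0).
  rewrite /C trmx_mul tr_diag_mx mulmxA -2!(mulmxA V) !mulmx_diag -mulmxA mxE.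
  apply: eq_bigr => l _; rewrite mul_diag_mx !mxE /hmod -(inj_eq val_inj) /= /N.
  move: (hentry t.+1 i l) (hentry t.+1 j l) (hnorm t.+1) => x y z.
  by case: (l == 0 :> nat) => /=; ring.
apply: (@q_mx_le_size R (k + t.+1) A [:: 0; s]).
rewrite horner_mx_prod_XsubC big_cons big_seq1 raddf0 subr0.
by rewrite mulrBr -mulmxE AA mul_mx_scalar subrr.
Qed.

(** With [k] and [t] the block sizes, vectors summing to zero on each part lie in the kernel. The
    quotient matrix [[0, t; k, a t]] has determinant [- k t]; the choice of [a] makes its trace
    [k t - 1], hence its eigenvalues [k t] and [-1]. *)
Lemma three_eigenvalues k t : (t < k)%N ->
  exists2 A : 'M[R]_(k.+1 + t.+1),
    graph_mx (empty_join_complete k.+1 t.+1) A & (q_mx A <= 3)%N.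
Proof.
move=> tk; pose p : R := (k.+1 * t.+1)%:R; pose a : R := (p - 1) / t.+1%:R.
have eat : a * t.+1%:R = p - 1 by rewrite mulfVK ?pnatr_eq0.
(* The clique needs [a != 0]; [t < k] gives [k.+1 >= 2], so [p != 1]. *)
have a0 : a != 0.
  rewrite mulf_neq0 ?invr_eq0 ?pnatr_eq0 // subr_eq0.
  by rewrite -[1]/(1%:R) eqr_nat; lia.
pose A : 'M[R]_(k.+1 + t.+1) :=
  block_mx (diag_mx 0) (const_mx 1) (const_mx 1)^T (const_mx a).
have JJ m n q (x y : R) :
    (const_mx x : 'M_(m, n)) *m (const_mx y : 'M_(n, q)) = const_mx (n%:R * x * y).
  apply/matrixP => i j; rewrite !mxE; under eq_bigr do rewrite !mxE.
  by rewrite sumr_const card_ord -mulrA mulr_natl.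
have cD m n (x y : R) : const_mx x + const_mx y = const_mx (x + y) :> 'M_(m, n).
  by apply/matrixP => i j; rewrite !mxE.
exists A.
  by apply: graph_mx_empty_join_complete => [i j||i j _];
    rewrite ?trmx_const ?mxE ?oner_eq0.
have eA : A = block_mx (const_mx 0) (const_mx 1) (const_mx 1) (const_mx a).
  by rewrite /A raddf0 trmx_const.
(* The relation [eat] cancels the off-diagonal blocks; multiplying what remains by [A] gives
   [p *: A]. *)
have eAA : A *m A - (p - 1) *: A =
    block_mx (const_mx t.+1%:R) (const_mx 0) (const_mx 0) (const_mx k.+1%:R).
  rewrite eA mulmx_block !JJ !cD scale_block_mx opp_block_mx add_block_mx -eat.
  by congr block_mx; apply/matrixP => i j; rewrite !mxE; ring.
have eA3 : A *m (A *m A - (p - 1) *: A - p%:M) = 0.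
  rewrite eAA mulmxBr mul_mx_scalar eA mulmx_block !JJ !cD.
  rewrite scale_block_mx opp_block_mx add_block_mx -[RHS]block_mx0.
  by congr block_mx; apply/matrixP => i j; rewrite !mxE /p natrM; ring: eat.
apply: (@q_mx_le_size R (k + t.+1) A [:: 0; p; -1]).
rewrite horner_mx_prod_XsubC !big_cons big_nil mulr1 raddf0 subr0.
have -> : (A - p%:M) * (A - (-1)%:M) = A *m A - (p - 1) *: A - p%:M.
  rewrite -mulmxE raddfN opprK mulmxDr mulmx1 mulmxBl mul_scalar_mx.
  by rewrite scalerBl scale1r opprB -!addrA [- _ + _]addrCA.
by rewrite -mulmxE; exact: eA3.
Qed.

End Realizations.

(* From the creation sequence to the canonical labelling *)
Local Close Scope ring_scope.

Theorem theorem5p3 (R : realType) (k1 t1 : nat) (G : sgraph (k1 + t1)) :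
  0 < k1 -> 0 < t1 ->
  threshold G (cat_tuple (nseq_tuple k1 false) (nseq_tuple t1 true)) ->
  (k1 <= t1 -> q_graph R G = 2) /\ (~ k1 <= t1 -> q_graph R G = 3).
Proof.
case: k1 t1 G => // k [//|t] G _ _ [_ [v Gv]].
have GJ i j : adj G (v i) (v j) = adj (empty_join_complete k.+1 t.+1) i j.
  wlog ij : i j / (i <= j)%N.
    by case: (leqP i j) => [|/ltnW] ij H; [|rewrite adj_sym [RHS]adj_sym]; apply: H.
  have [->|nij] := eqVneq i j; first by rewrite !adj_irr.
  have ltij : (i < j)%N by rewrite ltn_neqAle nij.
  rewrite Gv // (tnth_nth false).
  transitivity (nth false (nseq k.+1 false ++ nseq t.+1 true) j); first by [].
  rewrite nth_cat size_nseq !nth_nseq /= nij; have := ltn_ord j.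
  (* The larger index decides adjacency: if [j] is in the independent set, so is [i]. *)
  by case: (ltnP j k.+1) => jk jn; [lia|rewrite ltn_subLR // jn orbT].
rewrite (q_graph_relabel R GJ); split=> [kt|/negP].
  have [A JA qA] := two_eigenvalues R (kt : k <= t).
  have J01 i j : adj (empty_join_complete k.+1 t.+1) (lshift _ i) (rshift _ j).
    by rewrite /= eq_lrshift leq_addr orbT.
  apply: (q_graph_eq JA qA) => B JB.
  exact: (@q_mx_ge2 R (k + t.+1) _ B _ _ (J01 ord0 ord0) JB).
rewrite -ltnNge ltnS => tk; have [A JA qA] := three_eigenvalues R tk.
by apply: (q_graph_eq JA qA) => B; apply: q_mx_ge3.
Qed.
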